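(* Let $n \ge 1$ and $\lambda > 0$. Let $\mathrm{lse}:\mathbb{R}^n\to\mathbb{R}$, $\mathrm{lse}(z) = \lambda^{-1}\log\left(\sum_{j=1}^n \exp(\lambda z_j)\right)$, be the log-sum-exp function, and let $\sigma:\mathbb{R}^n\to\mathbb{R}^n$, $\sigma_i(z) = \frac{\exp(\lambda z_i)}{\sum_{j=1}^n\exp(\lambda z_j)}$ for $1\le i\le n$, be the softmax function. Then the softmax function is the gradient of the log-sum-exp function, that is, $\sigma(z) = \nabla\,\mathrm{lse}(z)$ for all $z\in\mathbb{R}^n$.
   Context: All logarithms are to base $e$. The constant $\lambda>0$ is called the inverse temperature constant; the same $\lambda$ is used in $\sigma$ and $\mathrm{lse}$. *)

(* Defs.v *)
From mathcomp Require Import all_boot all_order all_algebra.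
From mathcomp Require Import all_classical all_reals all_analysis.

Set Implicit Arguments.
Unset Strict Implicit.
Unset Printing Implicit Defensive.

Import Order.TTheory GRing.Theory Num.Theory.
Import numFieldNormedType.Exports.

Local Open Scope ring_scope.

Definition lse (R : realType) (n : nat) (lambda : R) (z : 'rV[R]_n) : R :=
  lambda^-1 * ln (\sum_(j < n) expR (lambda * z 0 j)).

Definition softmax (R : realType) (n : nat) (lambda : R) (z : 'rV[R]_n) :
    'rV[R]_n :=
  \row_(i < n) (expR (lambda * z 0 i) / \sum_(j < n) expR (lambda * z 0 j)).

(* ['D_v f z] is total, so this is the gradient of [f] at [z] only when [f] is
   differentiable there; that has to be asserted separately. *)
Definition gradient (R : realType) (n : nat) (f : 'rV[R]_n -> R)
    (z : 'rV[R]_n) : 'rV[R]_n :=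
  \row_(i < n) ('D_(delta_mx 0 i) f z : R).

(* Main.v *)
From HB Require Import structures.
Require Import Defs.
From mathcomp Require Import all_boot all_order all_algebra.
From mathcomp Require Import all_classical all_reals all_analysis.

(** The log-sum-exp function is a composition of total differentiable maps:
    coordinate projections, scalings, [expR], a finite sum and [ln].  The last
    one is differentiable only on the positive half-line, and a sum of
    exponentials over a nonempty index set is positive.  The chain rule
    therefore gives Frechet differentiability and, at the same time, the
    differential
      [h |-> \sum_j h_j * expR (lambda * z_j) / \sum_j expR (lambda * z_j)],
    where the inner derivative [lambda] of each exponential cancels the outer
    factor [lambda^-1] ([is_diff_lse]).  The coefficient of [h_j] is the [j]-th
    softmax weight, so evaluating at the basis vectors reads off the
    gradient. *)

Set Implicit Arguments.
Unset Strict Implicit.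
Unset Printing Implicit Defensive.

Import Order.TTheory GRing.Theory Num.Theory.
Import numFieldNormedType.Exports.

Local Open Scope ring_scope.

Lemma is_diff_coord (R : realType) m n (M : 'M[R]_(m, n)) i j :
  is_diff M (fun N : 'M[R]_(m, n) => N i j : R) (fun N => N i j).
Proof.
apply: DiffDef; first exact: differentiable_coord.
(* [diff_lin] needs the projection as a bundled linear map. *)
have lin_coord : linear (fun N : 'M[R]_(m, n) => N i j : R).
  by move=> a A B; rewrite !mxE.
pose coordM := GRing.isLinear.Build _ _ _ _ _ lin_coord.
pose coordL : {linear _ -> _} :=
  HB.pack (fun N : 'M[R]_(m, n) => N i j : R) coordM.
rewrite (_ : (fun _ => _) = coordL) // diff_lin //.
exact: coord_continuous.
Qed.

Lemma is_diff_sum (R : realType) (V W : normedModType R) n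
    (f df : 'I_n -> V -> W) (x : V) :
  (forall i, is_diff x (f i) (df i)) ->
  is_diff x (\sum_(i < n) f i) (\sum_(i < n) df i).
Proof.
move=> fP; elim/big_ind2 : _ => //; first exact: is_diff_cst.
by move=> f1 df1 f2 df2 ? ?; exact: is_diffD.
Qed.

(** Lets the known derivatives of [expR] and [ln], stated for one real variable,
    enter the chain rule for maps on row vectors. *)
Lemma is_derive1_is_diff (R : realType) (f : R -> R) (x a : R) :
  is_derive x 1 f a -> is_diff x f (fun h => h * a).
Proof.
move=> fP; have df : differentiable f x.
  by apply/derivable1_diffP; exact: ex_derive.
by apply: DiffDef => //; rewrite diff1E // derive1E derive_val.
Qed.

Lemma sum_expR_gt0 (R : realType) n (u : 'I_n -> R) :
  (0 < n)%N -> 0 < \sum_(j < n) expR (u j).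
Proof.
case: n u => // n u _; rewrite big_ord_recl ltr_wpDr ?expR_gt0 //.
by apply: sumr_ge0 => j _; exact: expR_ge0.
Qed.

Lemma is_diff_sum_expR (R : realType) n (lambda : R) (z : 'rV[R]_n) :
  is_diff z (fun y : 'rV[R]_n => \sum_(j < n) expR (lambda * y 0 j))
    (fun h => \sum_(j < n) lambda * h 0 j * expR (lambda * z 0 j)).
Proof.
have term_diff (j : 'I_n) :
    is_diff z (fun y : 'rV[R]_n => expR (lambda * y 0 j))
      (fun h => lambda * h 0 j * expR (lambda * z 0 j)).
  have lP := is_diffZ lambda (is_diff_coord z 0 j).
  exact: is_diff_comp lP (is_derive1_is_diff (is_derive_expR _)).
have := is_diff_sum term_diff.
by rewrite !fct_sumE.
Qed.

(** Chaining [is_diff_sum_expR] with the logarithm: each exponential contributes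
    a factor [lambda], which the outer [lambda^-1] cancels, and the derivative
    of [ln] supplies the normalization of the softmax weights. *)
Lemma is_diff_lse (R : realType) n (lambda : R) (z : 'rV[R]_n) :
  (0 < n)%N -> lambda != 0 ->
  is_diff z (lse lambda : 'rV[R]_n -> R)
    (fun h => \sum_(j < n) h 0 j * softmax lambda z 0 j).
Proof.
move=> n_gt0 lambda_neq0.
have S_gt0 := sum_expR_gt0 (fun j => lambda * z 0 j) n_gt0.
have lnP := is_derive1_is_diff (is_derive1_ln S_gt0).
have := is_diffZ lambda^-1 (is_diff_comp (is_diff_sum_expR lambda z) lnP).
move/is_diff_eq; apply; apply/funext => h /=.
rewrite fctE /= /GRing.scale /= mulr_suml mulr_sumr; apply: eq_bigr => j _.
by rewrite mxE -!mulrA mulKf.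
Qed.

Theorem proposition1 (R : realType) (n : nat) (lambda : R)
    (hn : (1 <= n)%N) (hlambda : 0 < lambda) :
  forall z : 'rV[R]_n,
    differentiable (lse lambda : 'rV[R]_n -> R) z /\
    softmax lambda z = gradient (lse lambda) z.
Proof.
move=> z; have lseP := is_diff_lse z hn (lt0r_neq0 hlambda).
have lse_diff : differentiable (lse lambda : 'rV[R]_n -> R) z by exact: ex_diff.
split=> //; apply/rowP => i; rewrite [RHS]mxE deriveE // diff_val.
rewrite (bigD1 i) //= big1 => [|j j_neq_i].
  by rewrite addr0 [delta_mx _ _ _ _]mxE !eqxx mul1r.
by rewrite [delta_mx _ _ _ _]mxE (negbTE j_neq_i) andbF mul0r.
Qed.
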